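(* Let $x$ be a prime power with $x-1\equiv 0\pmod 6$, let $\alpha$ be a generator of $\mathbb F_x^*$, and for $1\le i\le 3$ let $c_i=|N(v)\cap N(u)|$, where $u,v\in\mathbb F_x$ are any vertices of $GP(x,3)$ with $u-v\in\alpha^{i-1}(\mathbb F_x^* )^3$ (this number does not depend on the choice of such $u,v$). Then for all vertices $u,v$ of $GP(x,3)$, $$H(GP(x,3);(v,u))=\begin{cases} 0 & u-v=0,\\[4pt] x-1 & u-v\in(\mathbb F_x^* )^3,\\[4pt] \dfrac{\frac{x-1}{3}\left(c_1(3c_2+3c_3+2)+3c_2(c_3+1)+4c_3+2\right)}{c_2(c_1+c_3+1)+(c_1+1)c_3} & u-v\in\alpha(\mathbb F_x^* )^3,\\[10pt] \dfrac{\frac{x-1}{3}\left(c_1(3c_2+3c_3+2)+c_2(3c_3+4)+3c_3+2\right)}{c_2(c_1+c_3+1)+(c_1+1)c_3} & u-v\in\alpha^2(\mathbb F_x^* )^3. \end{cases}$$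
   Context: $\mathbb F_x$ is the finite field with $x$ elements, $\mathbb F_x^*$ its multiplicative group, and $(\mathbb F_x^* )^k=\{n^k: n\in\mathbb F_x^*\}$. For a prime power $x$ and an integer $k\ge1$ with $x-1\equiv 0\pmod{2k}$, the generalized Paley graph $GP(x,k)$ has vertex set $\mathbb F_x$, with $n\sim m$ iff $n-m\in(\mathbb F_x^* )^k$. $N(v)$ is the neighbour set of $v$. $H(G;(v,u))$ denotes the average hitting time from $u$ to $v$: the expected number of steps needed to reach $v$ for the first time in a simple random walk on $G$ (each step moves to a uniformly chosen neighbour) starting from $u$, with $H(G;(v,v))=0$. *)

(* Defs.v *)
From HB Require Import structures.
From mathcomp Require Import all_boot all_order all_algebra all_fingroup.
From mathcomp Require Import all_solvable all_field.
From mathcomp Require Import all_classical all_reals all_analysis.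

Set Implicit Arguments.
Unset Strict Implicit.
Unset Printing Implicit Defensive.

Import Order.TTheory GRing.Theory Num.Theory.

Local Open Scope ring_scope.

(* For a finite field F, {unit F} is the multiplicative group of F. *)
Definition kth_powers (F : finFieldType) (k : nat) : {set F} :=
  [set val n ^+ k | n : {unit F}]%SET.

Definition power_coset (F : finFieldType) (k : nat) (a : F) : {set F} :=
  [set a * z | z in kth_powers F k]%SET.

Definition GP (F : finFieldType) (k : nat) : rel F :=
  fun n m => n - m \in kth_powers F k.

Arguments kth_powers F k : clear implicits.
Arguments GP F k : clear implicits.

Section RandomWalk.
Context (R : realType) (V : finType).
Implicit Types (e : rel V) (u v : V).

Definition neighbours e v : {set V} := [set w | e v w]%SET.

Definition step_prob e v w : R :=
  if w \in neighbours e v then #|neighbours e v|%:R^-1 else 0.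

Section Process.
Context (d : measure_display) (Omega : measurableType d).
Context (P : probability Omega R).
Implicit Types X : nat -> Omega -> V.

Local Open Scope classical_set_scope.

Definition follows X (n : nat) (w : nat -> V) : set Omega :=
  [set omega | forall i, (i <= n)%N -> X i omega = w i].

(* The last clause is the product form of
   P(X_{n+1} = w_{n+1} | X_0 = w_0, ..., X_n = w_n) = step_prob w_n w_{n+1},
   which also makes sense when the conditioning event has probability 0. *)
Record simple_random_walk e u X : Prop := SimpleRandomWalk {
  walk_measurable : forall n v, measurable (X n @^-1` [set v]) ;
  walk_start : P (X 0%N @^-1` [set u]) = 1%E ;
  walk_step : forall n (w : nat -> V),
    P (follows X n.+1 w) =
    (P (follows X n w) * (step_prob e (w n) (w n.+1))%:E)%E
}.

(* The first time at which X is at v: +oo if X never visits v. *)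
Definition first_hit X v (omega : Omega) : \bar R :=
  ereal_inf [set (n%:R)%:E | n in [set n | X n omega = v]].

Definition average_hitting_time X v : \bar R :=
  (\int[P]_omega first_hit X v omega)%E.

End Process.
End RandomWalk.

Local Lemma sum_divn_modn (f g : nat -> nat) (M N : nat) : (0 < N)%N ->
  (\sum_(0 <= k < M * N) f (k %/ N) * g (k %% N) =
   (\sum_(0 <= k < M) f k) * (\sum_(0 <= r < N) g r))%N.
Proof.
move=> N0; elim: M => [|M IH]; first by rewrite mul0n !(big_geq (leqnn 0)) mul0n.
rewrite mulSn addnC (@big_cat_nat _ _ _ (M * N)%N) ?leq_addr//= IH.
rewrite big_nat_recr//= mulnDl; congr addn.
rewrite -{1}[(M * N)%N]add0n big_addn addKn big_distrr/= !big_mkord.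
apply: eq_bigr => r _.
by rewrite divnDMl// modnMDl || rewrite addnC divnMDl// modnMDl modn_small// divn_small// addn0.
Qed.

(* A realization of the walk on [0, 1] with the uniform probability, driven by
   the successive digits of t in base N = #|V|!, a multiple of every degree:
   wk n k is the position after n steps when the first n digits of t form the
   integer k. *)
Section Existence.
Context (R : realType).
Notation Om := (measurableTypeR R).
Let P : probability Om R := uniform_prob (@ltr01 R).

Local Open Scope classical_set_scope.

Let A (M k : nat) : set Om := [set t | Num.truncn (M%:R * t) = k].

Local Lemma AE M k : (0 < M)%N -> A M k =
  (if k is 0 then [set` `]-oo, (M%:R^-1 : R)[%R]
   else [set` `[(k%:R / M%:R : R), k.+1%:R / M%:R[%R]).
Proof.
move=> M0; have M0' : 0 < M%:R :> R by rewrite ltr0n.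
case: k => [|k]; apply/seteqP; split => t /=; rewrite in_itv/=.
- move=> At; have := @truncnS_gt R (M%:R * t); rewrite At.
  by rewrite mulrC -ltr_pdivlMr// mul1r.
- move=> tM; apply/eqP; rewrite -leqn0 truncn_le_nat mulrC -ltr_pdivlMr//.
  by rewrite mul1r.
- move=> At; have t0 : 0 <= M%:R * t.
    rewrite leNgt; apply/negP => h.
    have : (Num.truncn (M%:R * t) <= 0)%N.
      by rewrite truncn_le_nat (lt_trans h).
    by rewrite At.
  have /andP[] := truncn_itv t0; rewrite At => h1 h2.
  by rewrite ler_pdivrMr// ltr_pdivlMr// mulrC h1 h2.
- rewrite ler_pdivrMr// ltr_pdivlMr// mulrC => h.
  exact: truncn_def.
Qed.

Local Lemma measA M k : (0 < M)%N -> measurable (A M k).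
Proof. by move=> M0; rewrite AE//; case: k. Qed.

Local Lemma PA M k : (k < M)%N -> P (A M k) = (M%:R^-1)%:E.
Proof.
move=> kM; have M0 : (0 < M)%N by case: M kM.
have M0' : 0 < M%:R :> R by rewrite ltr0n.
rewrite /P/= /uniform_prob integral_uniform_pdf.
have -> : A M k `&` `[0, 1]%classic =
    [set` `[(k%:R / M%:R : R), k.+1%:R / M%:R[%R].
  have ub : k.+1%:R / M%:R <= 1 :> R by rewrite ler_pdivrMr// mul1r ler_nat.
  have lb : 0 <= k%:R / M%:R :> R by rewrite divr_ge0.
  rewrite AE//; apply/seteqP; split => t /=; case: k kM ub lb => [|k] kM ub lb /=;
    rewrite !in_itv/=.
  - by rewrite mul0r mul1r => -[-> /andP[-> _]].
  - by case.
  - rewrite mul0r => /andP[-> h]; split; first by rewrite -[_^-1]mul1r.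
    exact/ltW/(lt_le_trans h).
  - move=> /andP[h1 h2]; rewrite h1 h2; split => //; apply/andP; split.
      exact: le_trans h1.
    exact/ltW/(lt_le_trans h2).
rewrite (eq_integral (fun=> 1%E)); last first.
  move=> t; rewrite inE/= in_itv/= => /andP[h1 h2]; rewrite /uniform_pdf.
  rewrite (le_trans _ h1) ?divr_ge0//= subr0 invr1.
  by rewrite (le_trans (ltW h2))// ler_pdivrMr// mul1r ler_nat.
rewrite integral_cst//= mul1e lebesgue_measure_itv/= lte_fin.
rewrite ltr_pM2r ?invr_gt0// ltr_nat ltnS leqnn -EFinD -mulrBl.
by rewrite -natrB// subSnn mul1r.
Qed.

Local Lemma SE M (Q : pred nat) :
  [set t : Om | Q (Num.truncn (M%:R * t))] = \bigcup_(k in [set k | Q k]) A M k.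
Proof.
apply/seteqP; split => t /=; first by move=> h; exists (Num.truncn (M%:R * t)).
by move=> [k /= Qk ->].
Qed.

Local Lemma measS M (Q : pred nat) : (0 < M)%N ->
  measurable [set t : Om | Q (Num.truncn (M%:R * t))].
Proof.
move=> M0; rewrite SE; apply: bigcup_measurable => k _; exact: measA.
Qed.

Local Lemma PSlt M (Q : pred nat) : (0 < M)%N ->
  P [set t | (Num.truncn (M%:R * t) < M)%N && Q (Num.truncn (M%:R * t))] =
  ((\sum_(0 <= k < M) Q k)%N%:R / M%:R)%:E.
Proof.
move=> M0.
rewrite (_ : mkset _ = \big[setU/set0]_(k < M | Q k) A M k); last first.
  rewrite -(bigcup_pred [pred k : 'I_M | Q k]); apply/seteqP; split => t /=.
    by move=> /andP[h1 h2]; exists (Ordinal h1).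
  by move=> [k /= Qk ->]; rewrite ltn_ord.
rewrite measure_bigsetU_ord_cond//=; last 2 first.
- by move=> k _; exact: measA.
- by move=> i j _ _ [t [h1 h2]]; apply/val_inj; rewrite /= -h1 -h2.
rewrite (eq_bigr (fun=> (M%:R^-1)%:E)); last by move=> k _; rewrite PA.
rewrite sumEFin; congr EFin.
rewrite big_mkcond/= natr_sum mulr_suml big_mkord; apply: eq_bigr => k _.
by case: (Q k); rewrite ?mul1r ?mul0r.
Qed.

Local Lemma PS M (Q : pred nat) : (0 < M)%N ->
  P [set t | Q (Num.truncn (M%:R * t))] = ((\sum_(0 <= k < M) Q k)%N%:R / M%:R)%:E.
Proof.
move=> M0; rewrite -PSlt//.
have mlt : measurable [set t : Om | (Num.truncn (M%:R * t) < M)%N].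
  exact: (measS (fun k => k < M)%N).
have P1 : P [set t : Om | (Num.truncn (M%:R * t) < M)%N] = 1%E.
  have := PSlt predT M0; rewrite (_ : mkset _ = [set t : Om | (Num.truncn (M%:R * t) < M)%N]).
    move=> ->; rewrite big_mkord sum1_card card_ord divff// pnatr_eq0.
    by rewrite -lt0n.
  by apply/seteqP; split => t /=; rewrite ?andbT.
have P0 : P (~` [set t : Om | (Num.truncn (M%:R * t) < M)%N]) = 0%E.
  by rewrite probability_setC// P1 subee.
rewrite -(setIT [set t : Om | Q _]) -(setUv [set t : Om | (Num.truncn (M%:R * t) < M)%N]).
rewrite setIUr measureU; first last.
- by rewrite setIACA setICr setI0.
- by apply: measurableI; [exact: measS|exact: measurableC].
- by apply: measurableI => //; exact: measS.
rewrite [X in (_ + X)%E](_ : _ = 0%E); last first.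
  apply/eqP; rewrite eq_le measure_ge0 andbT -P0; apply: le_measure => //.
  + rewrite inE; apply: measurableI; [exact: measS|exact: measurableC].
  + by rewrite inE; exact: measurableC.
rewrite adde0; congr (uniform_prob _ _).
by apply/seteqP; split => t /=; [move=> [-> ->]|move=> /andP[-> ->]].
Qed.

Context (V : finType) (e : rel V) (u : V).
Context (e_deg : forall v, (0 < #|neighbours e v|)%N).
Let N := ((#|V|)`!)%N.
Let N0 : (0 < N)%N. Proof. exact: fact_gt0. Qed.
Let deg_dvd v : (#|neighbours e v| %| N)%N.
Proof. by apply: dvdn_fact; rewrite e_deg max_card. Qed.

Let step v (r : nat) := nth v (enum (neighbours e v)) (r %% #|neighbours e v|)%N.
Local Fixpoint wk (n k : nat) : V :=
  if n is n'.+1 then step (wk n' (k %/ N)%N) (k %% N)%N else u.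
Let X n (t : Om) := wk n (Num.truncn ((N ^ n)%N%:R * t)).

Local Lemma count_step v w :
  ((\sum_(0 <= r < N) (step v r == w))%N%:R : R) = N%:R * step_prob R e v w.
Proof.
set dg := #|neighbours e v|.
have /dvdnP[q Nq] := deg_dvd v; rewrite Nq -/dg.
have dg0 : (0 < dg)%N := e_deg v.
under eq_bigr => r _ do rewrite -[nat_of_bool _]mul1n /step -/dg.
rewrite (sum_divn_modn (fun=> 1%N)
  (fun r => (nth v (enum (neighbours e v)) r == w) : nat))//.
rewrite !sum_nat_const_nat subn0 muln1.
have -> : (\sum_(0 <= r < dg) (nth v (enum (neighbours e v)) r == w) =
           (w \in neighbours e v))%N.
  rewrite -mem_enum -count_uniq_mem ?enum_uniq// -sum1_count [RHS]big_mkcond/=.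
  by rewrite [RHS](big_nth v) -cardE; apply: eq_bigr => r _; case: eqP.
rewrite /step_prob; case: ifP => _; rewrite ?muln0 ?mulr0// muln1 natrM.
by rewrite mulfK// pnatr_eq0 -lt0n.
Qed.

Local Fixpoint good (n : nat) (w : nat -> V) (k : nat) : bool :=
  if n is n'.+1 then good n' w (k %/ N)%N && (step (w n') (k %% N)%N == w n'.+1)
  else u == w 0%N.

Local Lemma truncn_divN (t : R) (m : nat) : (0 < m)%N ->
  (Num.truncn (m%:R * t) %/ m)%N = Num.truncn t.
Proof.
move=> m0; have m0' : 0 < m%:R :> R by rewrite ltr0n.
have [t0|t0] := leP 0 t.
  apply/esym/truncn_def; have /truncn_itv/andP[h1 h2] : 0 <= m%:R * t by rewrite mulr_ge0.
  set T := Num.truncn (m%:R * t) in h1 h2 *.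
  rewrite -(ler_pM2l m0') (le_trans _ h1)/= -?natrM ?ler_nat; last first.
    by rewrite mulnC leq_divM.
  rewrite -(ltr_pM2l m0') (lt_le_trans h2)// -natrM ler_nat mulnC.
  by rewrite ltn_ceil.
have tr0 (s : R) : s < 0 -> Num.truncn s = 0%N.
  by move=> s0; apply/eqP; rewrite -leqn0 truncn_le_nat (lt_trans s0).
by rewrite !tr0// ?div0n// pmulr_rlt0.
Qed.

Local Lemma XS n t : X n.+1 t = step (X n t) (Num.truncn ((N ^ n.+1)%N%:R * t) %% N)%N.
Proof.
rewrite /X /= expnS natrM -mulrA truncn_divN//.
Qed.

Local Lemma followsE n w : follows X n w =
  [set t | good n w (Num.truncn ((N ^ n)%N%:R * t))].
Proof.
elim: n => [|n IH].
  apply/seteqP; split => t /=; first by move=> /(_ 0%N erefl) <-; rewrite /X.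
  by move=> /eqP h i; rewrite leqn0 => /eqP ->; rewrite /X/=.
have -> : follows X n.+1 w = follows X n w `&` [set t | X n.+1 t = w n.+1].
  apply/seteqP; split => t /=.
    by move=> h; split; [move=> i /leqW /h|exact: h].
  by move=> [h1 h2] i; rewrite leq_eqVlt => /orP[/eqP ->//|/h1].
apply/seteqP; split => t /=.
  move=> [h1]; rewrite XS h1//.
  move: h1; rewrite -/(follows X n w t) IH/= expnS natrM -mulrA truncn_divN// => ->.
  by move=> ->/=.
rewrite [in good _ _ _]expnS natrM -mulrA truncn_divN// => /andP[h1 /eqP h2].
have h : follows X n w t by rewrite IH.
by split=> //; rewrite XS (h n).
Qed.

Local Lemma walk_exists : simple_random_walk P e u X.
Proof.
have NX n : (0 < N ^ n)%N by rewrite expn_gt0 N0.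
split.
- move=> n v; rewrite (_ : _ @^-1` _ = [set t | wk n (Num.truncn ((N ^ n)%N%:R * t)) == v]).
    exact: (measS (fun k => wk n k == v)).
  by apply/seteqP; split => t /= /eqP.
- rewrite (_ : _ @^-1` _ = setT) ?probability_setT//.
  by apply/seteqP; split => t.
- move=> n w; rewrite !followsE PS// PS// -EFinM; congr EFin.
  rewrite expnSr /=.
  under eq_bigr => k _ do rewrite -mulnb.
  rewrite (sum_divn_modn (fun k => good n w k : nat)
    (fun r => (step (w n) r == w n.+1) : nat))//.
  rewrite natrM count_step natrM invfM.
  set a := (\sum_(_ <= _ < _) _)%:R.
  have Nne : N%:R != 0 :> R by rewrite pnatr_eq0 -lt0n.
  by rewrite [N%:R * _]mulrC (mulrA a) mulrACA mulfV// mulr1 mulrAC.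
Qed.
End Existence.

Lemma simple_random_walk_exists (R : realType) (V : finType) (e : rel V)
    (u : V) : (forall v, (0 < #|neighbours e v|)%N) ->
  exists (d : measure_display) (Omega : measurableType d)
    (P : probability Omega R) (X : nat -> Omega -> V),
    simple_random_walk P e u X.
Proof.
move=> e_deg; do 4 eexists.
exact: (@walk_exists R V e u e_deg).
Qed.

(* Main.v *)
(* A nonnegative function h that vanishes at v and satisfies h = 1 + Q h
   elsewhere, Q being the transition operator of the walk killed at v, is the
   expected hitting time of v: telescoping gives
   sum_(i < n) P(T > i) = h u - (Q^n h) u, and Q^n h is at most a constant times
   P(T > n), which is the general term of a convergent series.

   On GP(x, 3), h depends only on the cubic class of the difference with v.  The
   cyclotomic numbers p_(ij)^l of order 3 are invariant under all permutations of
   i, j, l and under their simultaneous shift (-1 is a cube), so all those which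
   occur are c_1, c_2, c_3 and c_1 + 1.  The equations for h therefore
   form a 3 x 3 linear system; they sum up to h = x - 1 on the class of the cubes,
   and -D is the determinant of the 2 x 2 system left for the other classes. *)
Require Import Defs.
From HB Require Import structures.
From mathcomp Require Import all_boot all_order all_algebra all_fingroup.
From mathcomp Require Import all_solvable all_field.
From mathcomp Require Import all_classical all_reals all_analysis.
From mathcomp Require Import zify ring.

Set Implicit Arguments.
Unset Strict Implicit.
Unset Printing Implicit Defensive.

Import Order.TTheory GRing.Theory Num.Theory.

Local Open Scope ring_scope.

(** * Hitting times from the transition operator killed at the target *)

Section HittingTime.
Import numFieldNormedType.Exports.
Context (R : realType) (V : finType) (e : rel V) (v : V).
Implicit Types (f h : V -> R) (a b u : V).

Definition killed f a : R :=
  if a == v then 0 else \sum_b step_prob R e a b * f b.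

(** The start of the iteration: [iter n killed alive a] is the probability that a walk from [a] is
    off [v] at all times up to and including [n]. *)
Let alive a : R := (a != v)%:R.

Lemma step_prob_ge0 a b : 0 <= step_prob R e a b.
Proof. by rewrite /step_prob; case: ifP => // _; rewrite invr_ge0. Qed.

Lemma killed_le f h : (forall a, f a <= h a) ->
  forall a, killed f a <= killed h a.
Proof.
move=> fh a; rewrite /killed; case: eqP => // _.
by apply: ler_sum => b _; rewrite ler_wpM2l// step_prob_ge0.
Qed.

Lemma iter_killed_le n f h : (forall a, f a <= h a) ->
  forall a, iter n killed f a <= iter n killed h a.
Proof. by move=> fh; elim: n => //= n; exact: killed_le. Qed.

Lemma iter_killed_ge0 n f : (forall a, 0 <= f a) ->
  forall a, 0 <= iter n killed f a.
Proof.
move=> f0; elim: n => //= n IH a; rewrite /killed; case: eqP => // _.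
by apply: sumr_ge0 => b _; rewrite mulr_ge0// step_prob_ge0.
Qed.

Lemma iter_killedZ n c f a :
  iter n killed (fun b => c * f b) a = c * iter n killed f a.
Proof.
elim: n a => //= n IH a; rewrite /killed; case: eqP; rewrite ?mulr0// => _.
by rewrite mulr_sumr; apply: eq_bigr => b _; rewrite IH mulrCA.
Qed.

Lemma iter_killedD n f h a :
  iter n killed (fun b => f b + h b) a = iter n killed f a + iter n killed h a.
Proof.
elim: n a => //= n IH a; rewrite /killed; case: eqP; rewrite ?addr0// => _.
by rewrite -big_split; apply: eq_bigr => b _; rewrite IH mulrDr.
Qed.

Lemma eq_iter_killed n f h a : f =1 h -> iter n killed f a = iter n killed h a.
Proof. by move=> /funext ->. Qed.

Lemma alive_sum_cvg h u : (forall a, 0 <= h a) ->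
  (forall a, h a = alive a + killed h a) ->
  (series (fun n => iter n killed alive u) @ \oo --> h u)%classic.
Proof.
move=> h0 hE.
have alive0 a : 0 <= alive a by rewrite /alive ler0n.
have serE n : series (fun k => iter k killed alive u) n = h u - iter n killed h u.
  apply/eqP; rewrite eq_sym subr_eq; apply/eqP; elim: n => [|n IH].
    by rewrite /series/= big_geq// add0r.
  rewrite {}IH [in LHS](eq_iter_killed n u hE) iter_killedD -iterSr.
  by rewrite addrA seriesSr.
(* The terms are nonnegative, and by [serE] the partial sums never exceed [h u]. *)
have scvg : cvgn (series (fun n => iter n killed alive u)).
  apply: nondecreasing_is_cvgn.
    apply/nondecreasing_seqP => n; rewrite seriesSr lerDl.
    exact: iter_killed_ge0.
  by exists (h u) => _ [n _ <-]; rewrite serE lerBlDr lerDl iter_killed_ge0.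
have rem0 : (iter n killed h u @[n --> \oo] --> (0 : R))%classic.
  (* Since [V] is finite and [h v = 0], a multiple of [alive] dominates [h]; iterating, the
     remainder is at most that multiple of the general term, which tends to 0. *)
  have hle a : h a <= (\sum_b h b) * alive a.
    rewrite /alive; have [->|_] := eqVneq a v.
      by rewrite hE /alive /killed eqxx addr0 mulr0.
    by rewrite mulr1 (bigD1 a)//= lerDl sumr_ge0.
  have up : (((\sum_b h b) * iter n killed alive u) @[n --> \oo] --> (0 : R))%classic.
    rewrite -[X in (_ --> X)%classic](mulr0 (\sum_b h b)).
    apply: cvgM; first exact: cvg_cst.
    exact: cvg_series_cvg_0.
  apply: (squeeze_cvgr _ _ up); last exact: cvg_cst.
  near=> n; rewrite iter_killed_ge0//=.
  by rewrite -iter_killedZ iter_killed_le.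
rewrite (funext serE) -[X in (_ --> X)%classic]subr0; apply: cvgB => //; exact: cvg_cst.
Unshelve. all: by end_near. Qed.

Lemma measure_fibers d (T : measurableType d) (mu : {measure set T -> \bar R})
    (A : set T) (Y : T -> V) :
  measurable A -> (forall b, measurable (Y @^-1` [set b])%classic) ->
  mu A = (\sum_b mu (A `&` Y @^-1` [set b])%classic)%E.
Proof.
move=> mA mY; rewrite -big_enum/= fsbig_seq ?enum_uniq//.
rewrite -measure_fin_bigcup//; first 1 last.
- by move=> a b _ _ [t [[_ <-] [_ <-]]].
- by move=> b _; exact: measurableI.
congr (mu _); apply/seteqP; split=> t; last by move=> [b _ []].
by move=> At; exists (Y t) => //=; rewrite mem_enum.
Qed.

(** * The law of the first hitting time *)

Section Walk.
Context d (Omega : measurableType d) (P : probability Omega R).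
Context (u : V) (X : nat -> Omega -> V).
Hypothesis walkX : simple_random_walk P e u X.

Local Open Scope classical_set_scope.

Let avoids n : set Omega := [set t | forall i, (i <= n)%N -> X i t <> v].

Let measurable_fiber n b : measurable (X n @^-1` [set b]).
Proof. by case: walkX. Qed.

Let measurable_all n (A : nat -> set Omega) : (forall i, measurable (A i)) ->
  measurable [set t | forall i, (i <= n)%N -> A i t].
Proof.
move=> mA; rewrite (_ : mkset _ = \bigcap_(i in [set i | (i <= n)%N]) A i).
  by apply: bigcap_measurableType => i _.
by apply/seteqP; split=> t /= h i; exact: h.
Qed.

Let measurable_avoids n : measurable (avoids n).
Proof.
by apply: measurable_all => i; apply: measurableC; exact: measurable_fiber.
Qed.

Let measurable_follows n w : measurable (follows X n w).
Proof. by apply: measurable_all => i; exact: measurable_fiber. Qed.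

(** The Markov property, by induction on [m]: split by the value of [X n.+1], absorb it into the
    prescribed path by [walk_step], and restart from time [n.+1]. *)
Let follows_avoids m n (w : nat -> V) :
  P (follows X n w `&`
     [set t | forall i, (i <= m)%N -> X (n + i)%N t <> v]) =
  (P (follows X n w) * (iter m killed alive (w n))%:E)%E.
Proof.
elim: m n w => [|m IH] n w.
  rewrite /= /alive; have [wv|/eqP wv] := eqVneq (w n) v.
    rewrite mule0 (_ : _ `&` _ = set0) ?measure0//.
    apply/seteqP; split=> // t [fw /(_ 0%N isT)]; rewrite addn0 (fw n)//.
  rewrite mule1 (_ : _ `&` _ = follows X n w)//.
  apply/seteqP; split=> [t []//|t fw]; split=> // i.
  by rewrite leqn0 => /eqP->; rewrite addn0 (fw n).
rewrite /= {1}/killed; have [wv|/eqP wv] := eqVneq (w n) v.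
  rewrite mule0 (_ : _ `&` _ = set0) ?measure0//.
  apply/seteqP; split=> // t [fw /(_ 0%N isT)]; rewrite addn0 (fw n)//.
rewrite (@measure_fibers _ _ P _ (X n.+1))//; last first.
  apply: measurableI => //; apply: measurable_all => i.
  by apply: measurableC; exact: measurable_fiber.
rewrite -sumEFin ge0_sume_distrr; last first.
  by move=> b _; rewrite lee_fin mulr_ge0 ?step_prob_ge0 ?iter_killed_ge0.
apply: eq_bigr => b _.
(* Only the values of [w] up to [n] matter, so the value at [n.+1] may be reset to [b]. *)
pose w' i := if i == n.+1 then b else w i.
have w'E i : (i <= n)%N -> w' i = w i.
  by rewrite /w'; case: eqP => // ->; rewrite ltnn.
have w'b : w' n.+1 = b by rewrite /w' eqxx.
have -> : follows X n w = follows X n w'.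
  by apply/seteqP; split=> t fw i ni; rewrite fw// w'E.
rewrite EFinM muleA -[in step_prob _ _ _ _](w'E n)// -[b in step_prob _ _ _ b]w'b.
rewrite -(walk_step walkX) -[in RHS]w'b -IH; congr (P _).
apply/seteqP; split=> t.
  move=> [[fw av] /= Xb]; split.
    by move=> i; rewrite leq_eqVlt => /predU1P[->|/fw//]; rewrite w'b.
  by move=> i im; rewrite addSnnS; exact: av.
move=> [fw av]; split; last by rewrite /= fw.
split; first by move=> i /leqW /fw.
case=> [_|i im]; last by rewrite -addSnnS; exact: av.
by rewrite addn0 fw// w'E.
Qed.

Let P_avoids n : P (avoids n) = (iter n killed alive u)%:E.
Proof.
rewrite -[RHS]mul1e -(walk_start walkX).
have := follows_avoids n 0 (fun=> u); rewrite (_ : follows _ _ _ = X 0%N @^-1` [set u]).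
  move=> <-; rewrite (measure_fibers P (Y := X 0%N))// (bigD1 u)//=.
  rewrite big1 ?adde0 => [|b bu].
    by rewrite setIC.
  (* The walk starts at [u] only almost surely; paths starting elsewhere form a null set. *)
  apply: subset_measure0 (_ : P (~` (X 0%N @^-1` [set u])) = 0%E) => //.
  - exact: measurableI.
  - exact: measurableC.
  - by move=> t [_ /= ->]; exact/eqP.
  by rewrite probability_setC// (walk_start walkX) subee.
by apply/seteqP; split=> t /= => [/(_ 0%N isT)//|<- i]; rewrite leqn0 => /eqP->.
Qed.

(** The tail-sum formula T = sum_n 1_(T > n), pointwise and in the extended reals, so that a walk
    never visiting [v] is covered with both sides infinite. *)
Let first_hitE t : first_hit R X v t = (\sum_(n <oo) (\1_(avoids n) t)%:E)%E.
Proof.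
have ge0 n : (0%:E <= (\1_(avoids n) t : R)%:E)%E by rewrite lee_fin.
have [[m Xm]|nohit] := pselect (exists m, X m t = v); last first.
  rewrite /first_hit (_ : [set _ | _ in _] = set0); last first.
    by apply/seteqP; split=> // y [m Xm _]; apply: nohit; exists m.
  rewrite ereal_inf0; apply/esym/eqyP => M M0.
  (* All terms are 1 here, so [k] of them already exceed the arbitrary bound [M]. *)
  pose k := (Num.truncn M).+1; apply: (@le_trans _ _ k%:R%:E).
    by rewrite lee_fin ltW// truncnS_gt.
  have -> : (k%:R%:E = \sum_(0 <= n < k) (\1_(avoids n) t : R)%:E)%E.
    rewrite (eq_big_nat _ _ (F2 := fun=> 1%:E)) => [|i _].
      by rewrite sumEFin sumr_const_nat subn0.
    by rewrite indicE mem_set// => j _ Xj; apply: nohit; exists j.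
  exact: nneseries_lim_ge.
(* At the first visit [k], the terms below [k] are 1 and those from [k] on are 0, because [avoids k]
   includes time [k] itself. *)
have [k /eqP Xk kmin] := ex_minnP (ex_intro (fun n => X n t == v) m (introT eqP Xm)).
rewrite (@nneseries_split _ _ 0 k)// add0n eseries0 ?adde0 => [|i ki _]; last first.
  rewrite indicE memNset// => /(_ k ki); exact.
rewrite (eq_big_nat _ _ (F2 := fun=> 1%:E)) => [|i /andP[_ ik]]; last first.
  rewrite indicE mem_set// => j ji Xj; have := kmin j; rewrite Xj eqxx => /(_ isT).
  by rewrite leqNgt (leq_ltn_trans ji ik).
rewrite sumEFin sumr_const_nat subn0.
apply/eqP; rewrite eq_le; apply/andP; split.
  by apply: ereal_inf_lbound; exists k.
apply/ereal_infP => _ [j Xj <-]; rewrite lee_fin ler_nat kmin//.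
exact/eqP.
Qed.

(** Exchanging integral and sum of nonnegative terms turns the tail-sum formula into the sum of the
    P(T > n), evaluated by [alive_sum_cvg]. *)
Lemma average_hitting_timeE h : (forall a, 0 <= h a)%R ->
  (forall a, h a = if a == v then 0 else 1 + \sum_b step_prob R e a b * h b)%R ->
  average_hitting_time P X v = (h u)%:E.
Proof.
move=> h0 hE; rewrite /average_hitting_time.
under eq_integral do rewrite first_hitE.
rewrite integral_nneseries//; last first.
  move=> n; apply/measurable_realfun.measurable_EFinP.
  exact: measurable_realfun.measurable_indic.
rewrite (eq_eseriesr (g := fun n => (iter n killed alive u)%:E)); last first.
  by move=> n _; rewrite integral_indic// setIT; exact: P_avoids.
have cv : series (fun n => iter n killed alive u) @ \oo --> h u.
  apply: alive_sum_cvg => // a; rewrite hE /alive /killed.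
  by case: eqP; rewrite ?addr0.
rewrite -(cvg_lim _ cv)// -EFin_lim; last by apply/cvg_ex; exists (h u).
by apply: congr_lim; apply/funext => n; rewrite /= sumEFin.
Qed.

End Walk.
End HittingTime.

(** * Cubic classes of a field with 3k + 1 elements, k even *)

Section CubicClasses.
Context (F : finFieldType) (alpha : {unit F}) (k : nat).
Hypothesis alpha_gen : generator [set: {unit F}]%SET alpha.
Hypothesis cardF : #|F| = (3 * k).+1.
Hypothesis k_even : ~~ odd k.

Let z : F := val alpha.
Let w : F := z ^+ k.

(* As w is a primitive cube root of unity, the cosets of the group of cubes are
   the level sets of the cubic character a |-> a ^+ k. *)
Definition cubic_class i : {set F} := [set a | a ^+ k == w ^+ i]%SET.

Let k_gt0 : (0 < k)%N.
Proof. by have := finRing_gt1 F; rewrite cardF; case: (k). Qed.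

Let z_neq0 : z != 0.
Proof. by rewrite -unitfE; exact: (valP alpha). Qed.

Let order_alpha : #[alpha]%g = (3 * k)%N.
Proof.
rewrite /order; move/eqP: alpha_gen => <-.
by rewrite card_finField_unit cardF.
Qed.

Let expz_eq1 n : (z ^+ n == 1) = (3 * k %| n)%N.
Proof.
rewrite -order_alpha order_dvdn /z -FinRing.val_unitX -FinRing.val_unit1.
by rewrite (inj_eq val_inj).
Qed.

Let nonzero_expz (a : F) : a != 0 -> exists n, a = z ^+ n.
Proof.
move=> a0; have ua : a \is a GRing.unit by rewrite unitfE.
have : FinRing.Unit ua \in <[alpha]>%g.
  by move/eqP: alpha_gen => <-; rewrite inE.
by move=> /cycleP[n /(congr1 val)]; rewrite /= FinRing.val_unitX => ->; exists n.
Qed.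

Let w3 : w ^+ 3 = 1.
Proof. by apply/eqP; rewrite /w -exprM expz_eq1 mulnC. Qed.

Let w_neq0 i : w ^+ i != 0.
Proof. by rewrite !expf_neq0. Qed.

Let expw_eq1 n : (w ^+ n == 1) = (3 %| n)%N.
Proof. by rewrite /w -exprM expz_eq1 mulnC dvdn_pmul2l. Qed.

Lemma cubic_class_neq0 i a : a \in cubic_class i -> a != 0.
Proof.
rewrite inE; apply: contraTneq => ->; rewrite expr0n eqn0Ngt k_gt0 /=.
by rewrite eq_sym.
Qed.

Lemma cubic_classD3 i : cubic_class (i + 3) = cubic_class i.
Proof. by apply/setP => a; rewrite !inE exprD w3 mulr1. Qed.

Lemma cubic_classM i j a b : a \in cubic_class i ->
  (a * b \in cubic_class (i + j)) = (b \in cubic_class j).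
Proof.
by rewrite !inE exprMn exprD => /eqP->; rewrite (inj_eq (mulfI (w_neq0 i))).
Qed.

(** Evenness of [k] makes -1 a cube; this is also what makes the graph undirected. *)
Lemma cubic_classN i a : (- a \in cubic_class i) = (a \in cubic_class i).
Proof. by rewrite !inE exprNn -signr_odd (negbTE k_even) mul1r. Qed.

Lemma generator_cubic_class i : z ^+ i \in cubic_class i.
Proof. by rewrite inE /w -!exprM mulnC. Qed.

(** In a cyclic group of order 3k, the cubes are the elements killed by [k]: one inclusion is
    Lagrange, and for [z ^+ n] the other reads 3k | nk, hence 3 | n. *)
Lemma kth_powers3E : kth_powers F 3 = cubic_class 0.
Proof.
apply/setP => a; rewrite inE expr0; apply/imsetP/eqP => [[n _ ->]|ak].
  rewrite -exprM -FinRing.val_unitX (_ : (n ^+ _)%g = 1%g)//.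
  apply/eqP; rewrite -order_dvdn -order_alpha.
  rewrite [#[alpha]%g]/order; move/eqP: alpha_gen => <-.
  by apply: order_dvdG; rewrite inE.
have a0 : a != 0 by apply: (@cubic_class_neq0 0); rewrite inE ak.
have [n an] := nonzero_expz a0.
have /dvdnP[m nm] : (3 %| n)%N.
  by rewrite -(dvdn_pmul2r k_gt0) -expz_eq1 exprM -an ak.
by exists (alpha ^+ m)%g; rewrite ?inE// FinRing.val_unitX -exprM -nm.
Qed.

Lemma power_coset3E i : power_coset 3 (z ^+ i) = cubic_class i.
Proof.
apply/setP => a; rewrite /power_coset kth_powers3E.
have zi b := cubic_classM 0 b (generator_cubic_class i); rewrite addn0 in zi.
apply/imsetP/idP => [[b b0 ->]|ai]; first by rewrite zi.
have zK : z ^+ i * (a / z ^+ i) = a by rewrite mulrC divfK ?expf_neq0.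
by exists (a / z ^+ i); rewrite ?zK// -zi zK.
Qed.

(** The class of [z ^+ n] is the residue of [n] modulo 3. The form as a sum of indicators serves
    both for summing over a set and for case analysis. *)
Lemma cubic_class_partition (a : F) :
  ((a == 0%R) + (a \in cubic_class 0) + (a \in cubic_class 1)
   + (a \in cubic_class 2) = 1)%N.
Proof.
have [->|a0] := eqVneq a 0.
  have n0 i : (0 \in cubic_class i) = false.
    by apply/negP => /cubic_class_neq0; rewrite eqxx.
  by rewrite !n0.
have [n ->] := nonzero_expz a0.
have cE i : (i < 3)%N -> (z ^+ n \in cubic_class i) = (n %% 3 == i)%N.
  move=> i3; rewrite inE exprAC -/w {1}(divn_eq n 3) exprD mulnC exprM w3.
  rewrite expr1n mul1r; have := ltn_pmod n (isT : 0 < 3)%N.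
  have w1 : (w == 1) = false by rewrite -[w]expr1 expw_eq1.
  have w2 : (w ^+ 2 == 1) = false by rewrite expw_eq1.
  have w21 : (w ^+ 2 == w) = false.
    rewrite -{2}[w]mulr1 expr2 (inj_eq (mulfI _)) ?w1//.
    by rewrite -[w]expr1.
  case: (n %% 3)%N => [|[|[|//]]] _; case: i i3 => [|[|[|//]]] _;
    rewrite ?expr0 ?expr1 ?eqxx ?w1 ?w2 ?w21 // eq_sym ?w1 ?w2 ?w21 //.
rewrite !cE//; have := ltn_pmod n (isT : 0 < 3)%N.
by case: (n %% 3)%N => [|[|[|//]]].
Qed.

Lemma card_cubic_partition (A : {set F}) :
  #|A| = ((0%R \in A) + #|(A :&: cubic_class 0)%SET| + #|(A :&: cubic_class 1)%SET|
          + #|(A :&: cubic_class 2)%SET|)%N.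
Proof.
have cE (B : {set F}) : #|(A :&: B)%SET| = (\sum_(a in A) (a \in B))%N.
  by rewrite -sum1_card; under eq_bigl do rewrite inE; rewrite big_mkcondr.
have -> : (0%R \in A : nat) = (\sum_(a in A) (a == 0%R))%N.
  have [A0|A0] := boolP (0 \in A).
    by rewrite (bigD1 0)//= eqxx big1// => a /andP[_ /negbTE->].
  by rewrite big1// => a aA; apply/eqP; rewrite eqb0; apply: contraNneq A0 => <-.
rewrite !cE -!big_split/= -sum1_card; apply: eq_bigr => a _.
by rewrite cubic_class_partition.
Qed.

(** Multiplication by [z ^+ j] maps class 0 onto class [j], so three classes of equal size share the
    3k nonzero elements. *)
Lemma card_cubic_class i : #|cubic_class i| = k.
Proof.
have cE j : #|cubic_class j| = #|cubic_class 0|.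
  rewrite -[RHS](card_imset _ (mulfI (expf_neq0 j z_neq0))); apply: eq_card => a.
  have zj b := cubic_classM 0 b (generator_cubic_class j); rewrite addn0 in zj.
  have zK : z ^+ j * (a / z ^+ j) = a by rewrite mulrC divfK ?expf_neq0.
  apply/idP/imsetP => [aj|[b b0 ->]]; last by rewrite zj.
  by exists (a / z ^+ j); rewrite ?zK// -zj zK.
have := card_cubic_partition [set: F]%SET; rewrite !finset.setTI cardsT cardF inE.
by rewrite !cE; lia.
Qed.

(** For [d] in class l this is the cyclotomic number p_(ij)^l. It is attached to [d] itself until
    independence of the representative is proved. *)
Definition cubic_number d i j : nat :=
  #|[set y | (y \in cubic_class i) && (d - y \in cubic_class j)]%SET|.

Lemma cubic_numberC d i j : cubic_number d i j = cubic_number d j i.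
Proof.
rewrite /cubic_number -[LHS](card_imset _ (inv_inj (subKr d))); apply: eq_card => y.
apply/imsetP/idP => [[b]|]; rewrite !inE ?subKr => /andP[h1 h2].
  by move=> ->; rewrite subKr h1 h2.
by exists (d - y); rewrite ?inE ?subKr ?h1 ?h2.
Qed.

Lemma cubic_numberM a m d i j : a \in cubic_class m ->
  cubic_number (a * d) (m + i) (m + j) = cubic_number d i j.
Proof.
move=> am; have a0 := cubic_class_neq0 am.
rewrite /cubic_number -[RHS](card_imset _ (mulfI a0)); apply: eq_card => y.
have yE : a * (y / a) = y by rewrite mulrC divfK.
rewrite -{1}yE inE -mulrBr !(cubic_classM _ _ am).
apply/idP/imsetP => [ya|[b bij ->]].
  exists (y / a); last by rewrite yE.
  by rewrite inE.
by rewrite mulrC mulKf//; rewrite inE in bij.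
Qed.

(* The involution y |-> d * d' / y exchanges the roles of the class of d and of
   the class over which y ranges. *)
Lemma cubic_number_swap d d' l i j :
  d \in cubic_class l -> d' \in cubic_class i ->
  cubic_number d i j = cubic_number d' l j.
Proof.
move=> dl d'i.
have d0 := cubic_class_neq0 dl; have d'0 := cubic_class_neq0 d'i.
have dd'0 : d * d' != 0 by rewrite mulf_neq0.
have invK : involutive (fun y => d * d' / y).
  by move=> y; rewrite invf_div mulrCA divff ?mulr1.
have swapE e e' p q y : e \in cubic_class p -> e' \in cubic_class q ->
    (y \in cubic_class q) && (e - y \in cubic_class j) ->
    (e * e' / y \in cubic_class p) && (e' - e * e' / y \in cubic_class j).
  move=> ep e'q /andP[yq eyj]; have y0 := cubic_class_neq0 yq.
  (* The factor [e' / y] is a cube, and multiplying [e] and [-(e - y)] by it gives the two elements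
     wanted. *)
  have ye'0 : e' / y \in cubic_class 0.
    by move: e'q yq; rewrite !inE exprMn exprVn => /eqP-> /eqP->; rewrite divff.
  have -> : e * e' / y = e' / y * e by rewrite -mulrA mulrC.
  have -> : e' - e' / y * e = e' / y * - (e - y) by field.
  rewrite -[p]add0n (cubic_classM _ _ ye'0) ep/=.
  by rewrite -[j]add0n (cubic_classM _ _ ye'0) cubic_classN.
rewrite /cubic_number -[LHS](card_imset _ (inv_inj invK)); apply: eq_card => y.
apply/imsetP/idP => [[b bij ->]|ylj].
  by rewrite inE in bij; rewrite inE; exact: (swapE _ _ _ _ _ dl d'i bij).
exists (d * d' / y); last by rewrite invK.
by rewrite inE in ylj; rewrite inE (mulrC d); exact: (swapE _ _ _ _ _ d'i dl ylj).
Qed.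

(** Swapping with [z ^+ i] turns both sides into the same number, in which only the class [l] is
    left of [d] and [d']. *)
Lemma cubic_number_class d d' l i j :
  d \in cubic_class l -> d' \in cubic_class l ->
  cubic_number d i j = cubic_number d' i j.
Proof.
move=> dl d'l; have zi := generator_cubic_class i.
by rewrite (cubic_number_swap j dl zi) (cubic_number_swap j zi d'l).
Qed.

(** The [k] elements y with [d - y] a cube are sorted by the class of y; the first summand accounts
    for y = 0. *)
Lemma cubic_number_sum d : d != 0 ->
  ((d \in cubic_class 0) + cubic_number d 0 0 + cubic_number d 1 0
   + cubic_number d 2 0 = k)%N.
Proof.
move=> d0; pose A := [set y | d - y \in cubic_class 0]%SET.
have <- : #|A| = k.
  rewrite -(card_cubic_class 0) -[RHS](card_imset _ (inv_inj (subKr d))).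
  apply: eq_card => y; rewrite inE; apply/idP/imsetP => [dy|[b b0 ->]].
    by exists (d - y); rewrite ?subKr.
  by rewrite subKr.
rewrite card_cubic_partition /cubic_number.
have -> : (0 \in A) = (d \in cubic_class 0) by rewrite inE subr0.
by congr (_ + _ + _ + _)%N; apply: eq_card => y; rewrite !inE andbC.
Qed.

(** * All cyclotomic numbers in terms of [c 1], [c 2], [c 3] *)

Section CubicNumbers.
Variable c : nat -> nat.
Hypothesis cE : forall i, (1 <= i <= 3)%N ->
  exists2 d, d \in cubic_class (i - 1) & c i = cubic_number d 0 0.

Let c_class i l d : d \in cubic_class l -> l = (i - 1)%N -> (1 <= i <= 3)%N ->
  cubic_number d 0 0 = c i.
Proof.
by move=> dl li /cE[d' d'l ->]; apply: cubic_number_class dl _; rewrite li.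
Qed.

Let one_class0 : 1 \in cubic_class 0.
Proof. exact: (generator_cubic_class 0). Qed.

Lemma cubic_numbers_class0 d : d \in cubic_class 0 ->
  [/\ cubic_number d 0 0 = c 1%N, cubic_number d 1 0 = c 2%N
    & cubic_number d 2 0 = c 3%N].
Proof.
move=> dl; have zi := generator_cubic_class.
split; first exact: c_class dl _ _.
- by rewrite (cubic_number_swap 0 dl (zi 1%N)); exact: c_class (zi 1%N) _ _.
- by rewrite (cubic_number_swap 0 dl (zi 2%N)); exact: c_class (zi 2%N) _ _.
Qed.

(** The sum rule at d = 1; the extra 1 is the term y = 0, as 1 is a cube. *)
Lemma degree_cubic : k = (c 1 + c 2 + c 3 + 1)%N.
Proof.
have [h1 h2 h3] := cubic_numbers_class0 one_class0.
by have := cubic_number_sum (oner_neq0 F); rewrite h1 h2 h3 one_class0; lia.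
Qed.

Let class01 a : a \in cubic_class 0 -> (a \in cubic_class 1) = false.
Proof.
have := cubic_class_partition a; case: (a \in cubic_class 1) => // + a0.
by rewrite a0; lia.
Qed.

Let class02 a : a \in cubic_class 0 -> (a \in cubic_class 2) = false.
Proof.
have := cubic_class_partition a; case: (a \in cubic_class 2) => // + a0.
by rewrite a0; lia.
Qed.

(** Scaling by [z ^+ 2] brings the second number back to class 0. The third is what the sum rule
    leaves: [d] is not a cube, so the 1 in [k] reappears as [(c 1).+1]. *)
Lemma cubic_numbers_class1 d : d \in cubic_class 1 ->
  [/\ cubic_number d 0 0 = c 2%N, cubic_number d 1 0 = c 3%N
    & cubic_number d 2 0 = (c 1%N).+1].
Proof.
move=> dl; have zi := generator_cubic_class.
have d0 : (d \in cubic_class 0) = false.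
  by apply/negP => /class01; rewrite dl.
have h0 : cubic_number d 0 0 = c 2%N by exact: c_class dl _ _.
have h1 : cubic_number d 1 0 = c 3%N.
  rewrite -(cubic_numberM d 1 0 (zi 2%N)) cubic_numberC.
  have -> : cubic_number (z ^+ 2 * d) (2 + 0) (2 + 1) =
            cubic_number (z ^+ 2 * d) 2 0.
    by rewrite /cubic_number (cubic_classD3 0).
  have zd : z ^+ 2 * d \in cubic_class 0.
    by rewrite -cubic_classD3 (cubic_classM 1 _ (zi 2%N)).
  by have [] := cubic_numbers_class0 zd.
split=> //; have := cubic_number_sum (cubic_class_neq0 dl).
by rewrite d0 h0 h1 degree_cubic; lia.
Qed.

(** A swap with [z] reduces the second number to class 1, and scaling by [z] reduces the third to
    class 0. *)
Lemma cubic_numbers_class2 d : d \in cubic_class 2 ->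
  [/\ cubic_number d 0 0 = c 3%N, cubic_number d 1 0 = (c 1%N).+1
    & cubic_number d 2 0 = c 2%N].
Proof.
move=> dl; have zi := generator_cubic_class; split; first exact: c_class dl _ _.
  rewrite (cubic_number_swap 0 dl (zi 1%N)).
  by have [] := cubic_numbers_class1 (zi 1%N).
rewrite -(cubic_numberM d 2 0 (zi 1%N)) cubic_numberC.
have -> : cubic_number (z ^+ 1 * d) (1 + 0) (1 + 2) =
          cubic_number (z ^+ 1 * d) 1 0.
  by rewrite /cubic_number (cubic_classD3 0).
have zd : z ^+ 1 * d \in cubic_class 0.
  by rewrite -cubic_classD3 (cubic_classM 2 _ (zi 1%N)).
by have [] := cubic_numbers_class0 zd.
Qed.

(* If c 2 = c 3 = 0, no nonzero element outside C0 is a sum of two cubes, so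
   every class is stable under nonzero sums and C0 + C1 is contained in C2; then 2 = (1 + z) + (1 - z) lies in C2 as well as in C0. *)
Lemma cubic_parameters_neq0 : (0 < c 2 + c 3)%N.
Proof.
rewrite lt0n addn_eq0; apply/negP => /andP[/eqP c2 /eqP c3].
(* The element [a] itself is counted by [cubic_number (a + b) 0 0], which would be 0 if [a + b] lay
   in class 1 or 2. *)
have sum0 a b : a \in cubic_class 0 -> b \in cubic_class 0 -> a + b != 0 ->
    a + b \in cubic_class 0.
  move=> a0 b0 ab0; have nab l : (0 < l < 3)%N -> a + b \notin cubic_class l.
    move=> l3; apply/negP => abl.
    have : cubic_number (a + b) 0 0 = 0%N.
      case: l l3 abl => [|[|[|//]]]// _ abl.
        by rewrite (c_class (i := 2) abl).
      by rewrite (c_class (i := 3) abl).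
    move/eqP; rewrite cards_eq0 => /eqP/setP/(_ a).
    by rewrite finset.in_set0 inE addrC addKr a0 b0.
  have := cubic_class_partition (a + b); rewrite (negbTE ab0).
  by rewrite (negbTE (nab 1%N _))// (negbTE (nab 2%N _))//; case: (_ \in _).
have suml l a b : a \in cubic_class l -> b \in cubic_class l -> a + b != 0 ->
    a + b \in cubic_class l.
  have zl x := cubic_classM 0 x (generator_cubic_class l); rewrite addn0 in zl.
  have zK x : z ^+ l * (x / z ^+ l) = x by rewrite mulrC divfK ?expf_neq0.
  rewrite -(zK a) -(zK b) -mulrDr !zl mulf_eq0 negb_or => al bl /andP[_].
  exact: sum0.
(* A sum in class 0 or 1 would put [b], respectively [a], into that class as a nonzero difference of
   two of its elements. *)
have sum01 a b : a \in cubic_class 0 -> b \in cubic_class 1 ->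
    a + b \in cubic_class 2.
  move=> a0 b1; have ab0 : a + b != 0.
    rewrite addr_eq0; apply: contraTneq a0 => ->; rewrite cubic_classN.
    by apply/negP => /class01; rewrite b1.
  have /negbTE nab0 : a + b \notin cubic_class 0.
    apply/negP => ab; have bE := addKr a b.
    have : - a + (a + b) \in cubic_class 0.
      by apply: sum0; rewrite ?cubic_classN// bE (cubic_class_neq0 b1).
    by rewrite bE => /class01; rewrite b1.
  have /negbTE nab1 : a + b \notin cubic_class 1.
    apply/negP => ab; have aE := addrK b a.
    have : a + b - b \in cubic_class 1.
      by apply: suml; rewrite ?cubic_classN// aE (cubic_class_neq0 a0).
    by rewrite aE (class01 a0).
  have := cubic_class_partition (a + b).
  by rewrite (negbTE ab0) nab0 nab1; case: (_ \in _).
(* The order of [F] is odd and annihilates 1, so 2 = 0 would give 1 = 0. *)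
have two0 : 2 != 0 :> F.
  have : (1 : F) *+ #|F| = 0.
    by rewrite -FinRing.zmodXgE -cardsT expg_cardG ?inE.
  rewrite cardF mulrS -(odd_double_half (3 * k)) oddM (negbTE k_even) add0n.
  rewrite -mul2n mulrnA; apply: contra_eq_neq => ->.
  by rewrite mul0rn addr0 oner_neq0.
have z1 := generator_cubic_class 1; rewrite expr1 in z1.
have two2 : 2 \in cubic_class 2.
  have -> : 2 = (1 + z) + (1 - z) by ring.
  by apply: suml; rewrite ?sum01 ?cubic_classN// (_ : _ + _ = 2)//; ring.
by have := class02 (sum0 _ _ one_class0 one_class0 two0); rewrite two2.
Qed.

End CubicNumbers.

(** * Neighbourhoods and steps of the walk on GP(x, 3) *)

Lemma mem_neighbours_GP3 u v :
  (v \in neighbours (GP F 3) u) = (u - v \in cubic_class 0).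
Proof. by rewrite inE /GP kth_powers3E. Qed.

(** Translation by [v]: a common neighbour y splits [u - v] into the cubes [y - v] and [u - y]. *)
Lemma common_neighboursE u v :
  #|(neighbours (GP F 3) v :&: neighbours (GP F 3) u)%SET|
  = cubic_number (u - v) 0 0.
Proof.
rewrite /cubic_number -[RHS](card_imset _ (addIr v)); apply: eq_card => y.
rewrite finset.in_setI !mem_neighbours_GP3 -cubic_classN opprB.
have uy : u - y = u - v - (y - v) by rewrite opprB addrA subrK.
apply/idP/imsetP => [yuv|[b buv yb]].
  by exists (y - v); rewrite ?subrK// inE -uy.
by rewrite inE in buv; rewrite uy yb addrK.
Qed.

(** The chance that one step from [u] lands in class [i] relative to [v]. Since it depends only on
    the class of [u - v], the hitting equations close up on functions of the class. *)
Lemma step_prob_cubic (R : realType) u v i :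
  \sum_y step_prob R (GP F 3) u y * (y - v \in cubic_class i)%:R
  = (cubic_number (u - v) i 0)%:R / k%:R.
Proof.
have deg : #|neighbours (GP F 3) u| = k.
  rewrite -[RHS](card_cubic_class 0) -[RHS](card_imset _ (inv_inj (subKr u))).
  apply: eq_card => y; rewrite mem_neighbours_GP3.
  apply/idP/imsetP => [uy|[b b0 ->]]; last by rewrite subKr.
  by exists (u - y); rewrite ?subKr.
rewrite /cubic_number -sum1_card natr_sum mulr_suml.
rewrite (reindex (fun y => y + v)) /=; last first.
  by exists (fun y => y - v) => y _; rewrite ?addrK ?subrK.
rewrite [RHS]big_mkcond/=; apply: eq_bigr => y _; rewrite addrK.
have -> : (y \in [set y | (y \in cubic_class i) && (u - v - y \in cubic_class 0)]%SET)
  = (y \in cubic_class i) && (u - v - y \in cubic_class 0) by rewrite inE.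
rewrite /step_prob mem_neighbours_GP3 deg opprD addrA addrAC.
by case: (y \in _); case: (_ \in _); rewrite ?mulr1 ?mulr0 ?mul1r.
Qed.

End CubicClasses.

Theorem theorem6p2 (R : realType) (F : finFieldType) (alpha : {unit F})
    (c : nat -> nat) :
  (#|F| - 1 = 0 %[mod 6])%N ->
  generator [set: {unit F}]%SET alpha ->
  (forall i : nat, (1 <= i <= 3)%N -> exists u v : F,
     u - v \in power_coset 3 (val alpha ^+ (i - 1)) /\
     c i = #|(neighbours (GP F 3) v :&: neighbours (GP F 3) u)%SET|) ->
  (forall (i : nat) (u v : F), (1 <= i <= 3)%N ->
     u - v \in power_coset 3 (val alpha ^+ (i - 1)) ->
     #|(neighbours (GP F 3) v :&: neighbours (GP F 3) u)%SET| = c i) /\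
  (forall (u v : F) (d : measure_display) (Omega : measurableType d)
     (P : probability Omega R) (X : nat -> Omega -> F),
   simple_random_walk P (GP F 3) u X ->
   let H := average_hitting_time P X v in
   let x : R := #|F|%:R in
   let c1 : R := (c 1%N)%:R in
   let c2 : R := (c 2%N)%:R in
   let c3 : R := (c 3%N)%:R in
   let D : R := c2 * (c1 + c3 + 1) + (c1 + 1) * c3 in
   [/\ u - v = 0 -> H = 0%E,
       u - v \in kth_powers F 3 -> H = (x - 1)%:E,
       u - v \in power_coset 3 (val alpha) ->
         H = ((x - 1) / 3 * (c1 * (3 * c2 + 3 * c3 + 2)
                + 3 * c2 * (c3 + 1) + 4 * c3 + 2) / D)%:E
     & u - v \in power_coset 3 (val alpha ^+ 2) ->
         H = ((x - 1) / 3 * (c1 * (3 * c2 + 3 * c3 + 2)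
                + c2 * (3 * c3 + 4) + 3 * c3 + 2) / D)%:E]).
Proof.
move=> F6 alpha_gen cE0; pose k := ((#|F| - 1) %/ 3)%N.
have F1 : (1 < #|F|)%N := finRing_gt1 F.
have cardF : #|F| = (3 * k).+1 by rewrite /k; lia.
have k_even : ~~ odd k.
  by have -> : k = (2 * ((#|F| - 1) %/ 6))%N; [rewrite /k; lia | rewrite oddM].
have cosetE := power_coset3E alpha_gen cardF.
have cubesE := kth_powers3E alpha_gen cardF.
have common_nbE := common_neighboursE alpha_gen cardF k_even.
have cE i : (1 <= i <= 3)%N -> exists2 d, d \in cubic_class alpha k (i - 1) &
    c i = cubic_number alpha k d 0 0.
  by move=> /cE0[u [v []]]; rewrite cosetE common_nbE; exists (u - v).
split=> [i u v i3|u v d Omega P X walkX H x c1 c2 c3 D].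
  rewrite cosetE common_nbE => uvi; have [d' d'i ->] := cE i i3.
  exact: (cubic_number_class cardF k_even _ _ uvi d'i).
have D_gt0 : 0 < D.
  (* The regrouping isolates [c2 + c3], the part known to be positive. *)
  have -> : D = c2 + c3 + (c2 * c1 + c2 * c3 + c1 * c3) by rewrite /D; ring.
  rewrite ltr_pwDl ?addr_ge0 ?mulr_ge0 ?ler0n// -natrD ltr0n.
  exact: (cubic_parameters_neq0 alpha_gen cardF k_even cE).
have kE : k%:R = c1 + c2 + c3 + 1 :> R.
  by rewrite (degree_cubic alpha_gen cardF k_even cE) !natrD.
have xE : x = 3 * k%:R + 1 by rewrite /x cardF -addn1 natrD natrM.
have k_gt0 : 0 < k%:R :> R by rewrite kE ltr_wpDl// !addr_ge0 ?ler0n.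
(* The two claimed values are kept as atoms known by an equation, to be expanded only when the
   linear system is checked. *)
have [H1 H1E] : {y | y = (x - 1) / 3 * (c1 * (3 * c2 + 3 * c3 + 2)
    + 3 * c2 * (c3 + 1) + 4 * c3 + 2) / D} by eexists.
have [H2 H2E] : {y | y = (x - 1) / 3 * (c1 * (3 * c2 + 3 * c3 + 2)
    + c2 * (3 * c3 + 4) + 3 * c3 + 2) / D} by eexists.
(* The candidate solution, constant on each class; all three indicators vanish at [a = v], which
   gives the value 0 there. *)
pose h a : R := (x - 1) * (a - v \in cubic_class alpha k 0)%:R
  + H1 * (a - v \in cubic_class alpha k 1)%:R
  + H2 * (a - v \in cubic_class alpha k 2)%:R.
have D_neq0 : c2 * (c1 + c3 + 1) + (c1 + 1) * c3 != 0 by rewrite gt_eqF.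
have s_neq0 : c1 + c2 + c3 + 1 != 0 by rewrite -kE gt_eqF.
have h_sum a : \sum_b step_prob R (GP F 3) a b * h b =
    ((x - 1) * (cubic_number alpha k (a - v) 0 0)%:R
     + H1 * (cubic_number alpha k (a - v) 1 0)%:R
     + H2 * (cubic_number alpha k (a - v) 2 0)%:R) / k%:R.
  rewrite 2!mulrDl -!mulrA -!(step_prob_cubic alpha_gen cardF k_even).
  rewrite !mulr_sumr -!big_split; apply: eq_bigr => b _ /=.
  rewrite /h; ring.
have x1 : 0 <= x - 1 by rewrite xE addrK mulr_ge0 ?ler0n.
have [H1_ge0 H2_ge0] : 0 <= H1 /\ 0 <= H2.
  rewrite H1E H2E; split; repeat first [ exact: x1 | exact: ler0n | exact: ltW
    | rewrite invr_ge0 | apply: mulr_ge0 | apply: addr_ge0 ].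
have HE : H = (h u)%:E.
  apply: (average_hitting_timeE walkX) => a.
    by rewrite !addr_ge0 ?mulr_ge0.
  have := cubic_class_partition alpha_gen cardF (a - v); rewrite subr_eq0 h_sum /h.
  case: eqP => _.
    by do 3![case: (_ \in _) => //]; rewrite !mulr0 !addr0.
  have numbers0 := @cubic_numbers_class0 _ _ _ cardF k_even _ cE (a - v).
  have numbers1 := @cubic_numbers_class1 _ _ _ alpha_gen cardF k_even _ cE (a - v).
  have numbers2 := @cubic_numbers_class2 _ _ _ alpha_gen cardF k_even _ cE (a - v).
  move: numbers0 numbers1 numbers2.
  (* The partition identity leaves three cases, one for each equation of the linear system; the
     denominators to clear are [D] and the degree [c1 + c2 + c3 + 1]. *)
  case: (_ \in _); case: (_ \in _); case: (_ \in _) => //= n0 n1 n2 _.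
  - have [-> -> ->] := n0 isT; rewrite -/c1 -/c2 -/c3.
    by rewrite H1E H2E xE kE /D; field; rewrite D_neq0 s_neq0.
  - have [-> -> ->] := n1 isT; rewrite -/c1 -/c2 -/c3 -natr1 -/c1.
    by rewrite H1E H2E xE kE /D; field; rewrite D_neq0 s_neq0.
  - have [-> -> ->] := n2 isT; rewrite -/c1 -/c2 -/c3 -natr1 -/c1.
    by rewrite H1E H2E xE kE /D; field; rewrite D_neq0 s_neq0.
have hE l : u - v \in cubic_class alpha k l -> (l < 3)%N ->
    h u = if l is 0 then x - 1 else if l is 1 then H1 else H2.
  have := cubic_class_partition alpha_gen cardF (u - v); rewrite /h.
  case: l => [|[|[|//]]] + ul _; rewrite ul;
    case: (_ == _); do 2![case: (_ \in _)] => //= _;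
    by rewrite !(mulr0, mulr1, addr0, add0r).
rewrite HE cubesE -(expr1 (val alpha)) !cosetE; split=> [uv0|ul|ul|ul].
- have := cubic_class_partition alpha_gen cardF (u - v); rewrite uv0 eqxx /h uv0.
  by do 3![case: (_ \in _) => //]; rewrite !mulr0 !addr0.
- by rewrite (hE _ ul).
- by rewrite (hE _ ul)// H1E.
- by rewrite (hE _ ul)// H2E.
Qed.
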